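(* Let $(G,\cdot)$ be an action-synchronized $\lim_{n\to\infty}(\Phi_{1/n},\Psi_{1/n})$-group for an action $\Gamma:G\to\mathrm{Aut}(G)$, and assume that $G$ is a $\lim_{n\to\infty}(\Phi_{1/n},\Psi_{1/n})$-abelian group. (1) Let $\mathfrak D:G\to G$ be a relative differential operator with limit-weight $\lim_{n\to\infty}(\Phi_{1/n},\Psi_{1/n})$ on $(G,\cdot)$ for the action $\Gamma$. Define $$\prec:G\times G\to G,\qquad a\prec b:=\lim_{n\to\infty}\Psi_{1/n}\Big(\Gamma_a\big(\Phi_{1/n}(\mathfrak D(b))\big)\Big).$$ Then $(G,\prec)$ is a Novikov group with limit-weight $\lim_{n\to\infty}(\Phi_{1/n},\Psi_{1/n})$ for the action $\Gamma$. (2) Let $(G,\prec)$ be a Novikov group with limit-weight $\lim_{n\to\infty}(\Phi_{1/n},\Psi_{1/n})$ for the action $\Gamma$. Then the map $\mathfrak D:G\to G$, $a\mapsto e\prec a$, is a relative differential operator with limit-weight $\lim_{n\to\infty}(\Phi_{1/n},\Psi_{1/n})$ on $(G,\cdot)$ for the action $\Gamma$.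
   Context: Synchronized limits: let $T$ be a topological space and $f_n:T\times T\to T$ ($n\ge1$) maps such that $\lim_{n\to\infty}f_n(a,b)$ uniquely exists for each $(a,b)$. The limit function is synchronized if $\lim_n f_n(a,b)=\lim_n f_n(a_n,b_n)$ for all sequences $a_n\to a$, $b_n\to b$ in $T$. A $\lim_{n\to\infty}(\Phi_{1/n},\Psi_{1/n})$-group is a topological group $G$ with maps $\Phi_{1/n},\Psi_{1/n}:G\to G$ ($n\ge 1$) such that $\Phi_{1/n}\Psi_{1/n}=\mathrm{id}_G$ for each $n$, the limit $a\cdot_\infty b:=\lim_n\Psi_{1/n}(\Phi_{1/n}(a)\Phi_{1/n}(b))$ uniquely exists for all $a,b\in G$, and the resulting map $\cdot_\infty:G\times G\to G$ is synchronized. The pair is unital if $\Phi_{1/n}(e)=\Psi_{1/n}(e)=e$. The group is complete if $\lim_n\Psi_{1/n}(e)$ and $\lim_n\Psi_{1/n}(\Phi_{1/n}(a)^{-1})$, $a\in G$, uniquely exist. It is a $\lim_n(\Phi_{1/n},\Psi_{1/n})$-abelian group if it is complete, the pairs are unital and $\cdot_\infty$ is commutative. For an action $\Gamma:G\to\mathrm{Aut}(G)$, $a\mapsto\Gamma_a$, the group is action-synchronized for $\Gamma$ if for all $a,b\in G$ the limit $\lim_n\Psi_{1/n}(\Gamma_a(\Phi_{1/n}(b)))$ uniquely exists and equals $\lim_n\Psi_{1/n}(\Gamma_a(\Phi_{1/n}(b_n)))$ for every sequence $b_n\to b$. A relative differential operator with limit-weight is a map $\mathfrak D:G\to G$ with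 $$\mathfrak D(ab)=\lim_{n\to\infty}\Psi_{1/n}\Big(\Phi_{1/n}(\mathfrak D(a))\,\Gamma_a\big(\Phi_{1/n}(\mathfrak D(b))\big)\Big),\quad a,b\in G.$$ A Novikov group with limit-weight $\lim_n(\Phi_{1/n},\Psi_{1/n})$ for the action $\Gamma$ is a pair $(G,\prec)$ where $G$ is an action-synchronized $\lim_n(\Phi_{1/n},\Psi_{1/n})$-group for $\Gamma$ and also a $\lim_n(\Phi_{1/n},\Psi_{1/n})$-abelian group, and $\prec$ is a binary operation on $G$ such that for all $a,b,c\in G$: $a\prec e=e$; $a\prec(bc)=(a\prec b)\cdot_\infty((ab)\prec c)$; and $\lim_{n\to\infty}\Psi_{1/n}\big(\Gamma_a(\Phi_{1/n}(b\prec c))\big)=(ab)\prec c$. *)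

(* Defs.v *)
From HB Require Import structures.
From mathcomp Require Import all_boot.
From mathcomp Require Import classical_sets filter topology.

Set Implicit Arguments.
Unset Strict Implicit.
Unset Printing Implicit Defensive.

Local Open Scope classical_set_scope.
Local Open Scope group_scope.

HB.mixin Record isTopologicalGroup G & Topological G & Group G := {
  mulg_continuous : continuous (fun x : G * G => x.1 * x.2);
  invg_continuous : continuous (fun x : G => x^-1)
}.

(* No separation axiom is assumed. The base point is only the value that the
   library's [lim] takes on sequences without a limit. *)
#[short(type="topologicalGroupType")]
HB.structure Definition TopologicalGroup :=
  {G of isTopologicalGroup G & Pointed G & Topological G & Group G}.

Section UniqueLimits.
Variable T : topologicalType.

(* "lim_n u_n = l" in a space that need not be Hausdorff. *)
Definition unique_limit (u : nat -> T) (l : T) : Prop :=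
  u @ \oo --> l /\ forall l', u @ \oo --> l' -> l' = l.

Definition has_unique_limit (u : nat -> T) : Prop :=
  exists l, unique_limit u l.

End UniqueLimits.

Definition synchronized (T : ptopologicalType) (f : nat -> T -> T -> T) : Prop :=
  forall (a b : T) (a_ b_ : nat -> T),
    a_ @ \oo --> a -> b_ @ \oo --> b ->
    unique_limit (fun n => f n (a_ n) (b_ n)) (limn (fun n => f n a b)).

(* [Phi n] and [Psi n] stand for Phi_{1/n} and Psi_{1/n}; the maps of index 0
   are unconstrained and play no role. *)
Section LimGroup.
Variables (G : topologicalGroupType) (Phi Psi : nat -> G -> G).

Definition scaled_mul (n : nat) (a b : G) : G := Psi n (Phi n a * Phi n b).

Definition lim_mul (a b : G) : G := limn (fun n => scaled_mul n a b).

Record lim_group : Prop := {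
  lim_groupK : forall n, (0 < n)%N -> cancel (Psi n) (Phi n);
  lim_group_cvg : forall a b, has_unique_limit (fun n => scaled_mul n a b);
  lim_group_sync : synchronized scaled_mul
}.

Definition unital : Prop :=
  forall n, (0 < n)%N -> Phi n 1 = 1 /\ Psi n 1 = 1.

Definition lim_complete : Prop :=
  has_unique_limit (fun n => Psi n 1) /\
  forall a, has_unique_limit (fun n => Psi n ((Phi n a)^-1)).

Record lim_abelian_group : Prop := {
  lim_abelian_group_lim_group : lim_group;
  lim_abelian_group_complete : lim_complete;
  lim_abelian_group_unital : unital;
  lim_abelian_groupC : commutative lim_mul
}.

(* [Gamma] is a group homomorphism from G to its group of (abstract group)
   automorphisms. *)
Record group_action (Gamma : G -> G -> G) : Prop := {
  group_action_morph : forall a, monoid_morphism (Gamma a);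
  group_action_bij : forall a, bijective (Gamma a);
  group_actionM : forall a b, Gamma (a * b) =1 Gamma a \o Gamma b
}.

Definition scaled_act (Gamma : G -> G -> G) (n : nat) (a b : G) : G :=
  Psi n (Gamma a (Phi n b)).

Record action_synchronized_lim_group (Gamma : G -> G -> G) : Prop := {
  action_sync_lim_group : lim_group;
  action_sync_action : group_action Gamma;
  action_sync_cvg : forall a b,
    has_unique_limit (fun n => scaled_act Gamma n a b);
  action_sync : forall (a b : G) (b_ : nat -> G), b_ @ \oo --> b ->
    unique_limit (fun n => scaled_act Gamma n a (b_ n))
                 (limn (fun n => scaled_act Gamma n a b))
}.

Definition relative_differential_operator
    (Gamma : G -> G -> G) (D : G -> G) : Prop :=
  forall a b,
    unique_limit (fun n => Psi n (Phi n (D a) * Gamma a (Phi n (D b))))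
                 (D (a * b)).

Record novikov_group (Gamma : G -> G -> G) (prec : G -> G -> G) : Prop := {
  novikov_action_sync : action_synchronized_lim_group Gamma;
  novikov_abelian : lim_abelian_group;
  novikov_prec1 : forall a, prec a 1 = 1;
  novikov_precM : forall a b c,
    prec a (b * c) = lim_mul (prec a b) (prec (a * b) c);
  novikov_act_prec : forall a b c,
    unique_limit (fun n => Psi n (Gamma a (Phi n (prec b c))))
                 (prec (a * b) c)
}.

End LimGroup.

(* Main.v *)
Require Import Defs.
From mathcomp Require Import all_boot.
From mathcomp Require Import classical_sets filter topology.

Set Implicit Arguments.
Unset Strict Implicit.
Unset Printing Implicit Defensive.

Local Open Scope classical_set_scope.
Local Open Scope group_scope.

(** Write [a *oo b] for the limit product and [a |> x] for the limit of
    Psi_n (Gamma_a (Phi_n x)).  Since Phi_n Psi_n = id, synchronization allows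
    nested limits to be merged into a single one, so that [*oo] is associative,
    [|>] is an action of G by endomorphisms of [*oo], and relative differential
    operators are exactly the solutions of [D (a * b) = D a *oo (a |> D b)].
    The Novikov axioms say the same of [a |> D b].  The one subtlety is that
    [1] need not be neutral for [*oo], since [a *oo 1] is the limit of
    Psi_n (Phi_n a), so that [D 1 = 1] takes an argument with limit inverses. *)

Section UniqueLimitTheory.
Variable T : ptopologicalType.
Implicit Types (u v : nat -> T) (l : T).

Lemma cvgn_cst l : (fun _ : nat => l) @ \oo --> l.
Proof. exact: cvg_cst. Qed.
Arguments cvgn_cst : clear implicits.

(** [Phi 0] and [Psi 0] are unconstrained, so the cancellation and unitality laws identify sequences
    only at positive indices. *)
Lemma eq_pos_cvg u v l :
  (forall n, (0 < n)%N -> u n = v n) -> u @ \oo --> l -> v @ \oo --> l.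
Proof.
move=> uv; apply: cvg_trans; apply: near_eq_cvg.
by exists 1%N => // n /=; apply: uv.
Qed.

Lemma eq_pos_unique_limit u v l :
  (forall n, (0 < n)%N -> u n = v n) -> unique_limit u l -> unique_limit v l.
Proof.
move=> uv [ul lU]; split; first exact: eq_pos_cvg ul.
by move=> l' vl'; apply: lU; apply: eq_pos_cvg vl' => n /uv.
Qed.

Lemma unique_limit_lim u l : unique_limit u l -> limn u = l.
Proof. by case=> ul; apply; apply: cvgP ul. Qed.

Lemma has_unique_limit_cvg u : has_unique_limit u -> u @ \oo --> limn u.
Proof. by case=> l ul; rewrite (unique_limit_lim ul); case: ul. Qed.

Lemma has_unique_limit_lim u l :
  has_unique_limit u -> u @ \oo --> l -> limn u = l.
Proof. by case=> l' ul' ul; rewrite (unique_limit_lim ul') (ul'.2 _ ul). Qed.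

End UniqueLimitTheory.

Arguments cvgn_cst {T} l.

Section LimMul.
Variables (G : topologicalGroupType) (Phi Psi : nat -> G -> G).
Hypothesis limG : lim_group Phi Psi.

Local Notation "a *oo b" := (lim_mul Phi Psi a b) (at level 40).

Let PsiK := lim_groupK limG.

Lemma scaled_mul_unique_limit {a_ b_ : nat -> G} {a b : G} :
  a_ @ \oo --> a -> b_ @ \oo --> b ->
  unique_limit (fun n => scaled_mul Phi Psi n (a_ n) (b_ n)) (a *oo b).
Proof. exact: lim_group_sync. Qed.

Lemma scaled_mul_cvg a b :
  (fun n => scaled_mul Phi Psi n a b) @ \oo --> a *oo b.
Proof. exact/has_unique_limit_cvg/lim_group_cvg. Qed.
Arguments scaled_mul_cvg : clear implicits.

(** Both bracketings merge into the limit of Psi_n (Phi_n a * Phi_n b * Phi_n c). *)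
Lemma lim_mulA : associative (lim_mul Phi Psi).
Proof.
move=> a b c.
have L := scaled_mul_unique_limit (cvgn_cst a) (scaled_mul_cvg b c).
have R := scaled_mul_unique_limit (scaled_mul_cvg a b) (cvgn_cst c).
rewrite -(unique_limit_lim R); apply/esym/unique_limit_lim.
apply: eq_pos_unique_limit L => n n0.
by rewrite /scaled_mul !PsiK // mulgA.
Qed.

Hypothesis unitG : unital Phi Psi.

Lemma Psi1_cvg : (fun n => Psi n 1) @ \oo --> (1 : G).
Proof. by apply: eq_pos_cvg (cvgn_cst 1) => n /unitG[]. Qed.

Lemma lim_mul_inv a : lim_complete Phi Psi -> exists a', a *oo a' = 1.
Proof.
(* The witness is the limit of Psi_n ((Phi_n a)^-1): its scaled product with [a] collapses to Psi_n
   1, whose unique limit is 1 by unitality. *)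
move=> [[l Psi1l] /(_ a)[a' [aV _]]]; exists a'.
have l1 : 1 = l by apply: Psi1l.2; apply: Psi1_cvg.
have := scaled_mul_unique_limit (cvgn_cst a) aV.
move=> /unique_limit_lim <-; rewrite l1; apply: unique_limit_lim.
apply: eq_pos_unique_limit Psi1l => n n0.
by rewrite /scaled_mul PsiK // mulgV.
Qed.

End LimMul.

Arguments scaled_mul_cvg {G Phi Psi} limG a b.

Section LimAct.
Variables (G : topologicalGroupType) (Phi Psi : nat -> G -> G).
Variable Gamma : G -> G -> G.
Hypothesis syncG : action_synchronized_lim_group Phi Psi Gamma.

Definition lim_act (a x : G) : G := limn (fun n => scaled_act Phi Psi Gamma n a x).

Local Notation "a *oo b" := (lim_mul Phi Psi a b) (at level 40).
Local Notation "a |> x" := (lim_act a x) (at level 35).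

Let limG := action_sync_lim_group syncG.
Let actG := action_sync_action syncG.
Let PsiK := lim_groupK limG.

Lemma Gamma_mulr a x y : Gamma a (x * y) = Gamma a x * Gamma a y.
Proof. by case: (group_action_morph actG a) => _; apply. Qed.

Lemma Gamma_1r a : Gamma a 1 = 1.
Proof. by case: (group_action_morph actG a). Qed.

(** [Gamma 1] is idempotent and injective. *)
Lemma Gamma_1l x : Gamma 1 x = x.
Proof.
apply: (bij_inj (group_action_bij actG 1)).
by have := group_actionM actG 1 1 x; rewrite mulg1.
Qed.

Lemma scaled_act_cvg a x :
  (fun n => scaled_act Phi Psi Gamma n a x) @ \oo --> a |> x.
Proof. exact/has_unique_limit_cvg/action_sync_cvg. Qed.
Arguments scaled_act_cvg : clear implicits.

Lemma scaled_act_unique_limit a {x_ : nat -> G} {x : G} : x_ @ \oo --> x ->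
  unique_limit (fun n => scaled_act Phi Psi Gamma n a (x_ n)) (a |> x).
Proof. exact: action_sync. Qed.

Lemma lim_actM a b x : a |> (b |> x) = (a * b) |> x.
Proof.
apply/esym/unique_limit_lim.
apply: eq_pos_unique_limit (scaled_act_unique_limit a (scaled_act_cvg b x)).
move=> n n0; rewrite /scaled_act PsiK //.
by rewrite (group_actionM actG).
Qed.

Lemma lim_act_mul a x y : a |> (x *oo y) = (a |> x) *oo (a |> y).
Proof.
have L := scaled_act_unique_limit a (scaled_mul_cvg limG x y).
have R := scaled_mul_unique_limit limG (scaled_act_cvg a x) (scaled_act_cvg a y).
rewrite -(unique_limit_lim R); apply/esym/unique_limit_lim.
apply: eq_pos_unique_limit L => n n0.
by rewrite /scaled_mul /scaled_act !PsiK // Gamma_mulr.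
Qed.

(** The sequence of the Leibniz rule is the scaled product of [x] with a sequence tending to
    [a |> y]. This gives both the value of the limit and its existence and uniqueness, which the
    converse direction needs. *)
Lemma lim_mul_act_unique_limit a x y :
  unique_limit (fun n => Psi n (Phi n x * Gamma a (Phi n y))) (x *oo (a |> y)).
Proof.
apply: eq_pos_unique_limit
  (scaled_mul_unique_limit limG (cvgn_cst x) (scaled_act_cvg a y)).
by move=> n n0; rewrite /scaled_mul /scaled_act PsiK.
Qed.

(** [1 |> y] may differ from [y], but a limit product does not see the difference. *)
Lemma lim_mul_act1 x y : x *oo (1 |> y) = x *oo y.
Proof.
rewrite -(unique_limit_lim (lim_mul_act_unique_limit 1 x y)) /lim_mul.
by congr (limn _); apply: boolp.funext => n; rewrite Gamma_1l.
Qed.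

Hypothesis unitG : unital Phi Psi.

Lemma lim_act_1r a : a |> 1 = 1.
Proof.
apply: has_unique_limit_lim; first exact: (action_sync_cvg syncG).
apply: eq_pos_cvg (cvgn_cst 1) => n n0.
by case: (unitG n0) => Phi1 Psi1; rewrite /scaled_act Phi1 Gamma_1r.
Qed.

(** Both sides are the limit of Psi_n (Phi_n x). *)
Lemma lim_act_1l x : 1 |> x = x *oo 1.
Proof.
apply/esym/unique_limit_lim.
apply: eq_pos_unique_limit (scaled_act_unique_limit 1 (cvgn_cst x)) => n n0.
case: (unitG n0) => Phi1 _.
by rewrite /scaled_mul /scaled_act Phi1 Gamma_1l mulg1.
Qed.

Section RelativeDifferentialOperator.
Variable D : G -> G.
Hypothesis diffD : relative_differential_operator Phi Psi Gamma D.

Lemma rel_diff_op_lim_mul a b : D (a * b) = D a *oo (a |> D b).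
Proof.
rewrite -(unique_limit_lim (diffD a b)).
exact/unique_limit_lim/lim_mul_act_unique_limit.
Qed.

(* [D 1] is idempotent for the limit product, so cancelling it with its limit
   inverse yields only [1 |> D 1 = 1]; substituting this back into the Leibniz
   rule gives [D 1 = D 1 *oo 1 = 1 |> D 1 = 1]. *)
Lemma rel_diff_op1 : lim_complete Phi Psi -> D 1 = 1.
Proof.
move=> complG; have D11 : D 1 = D 1 *oo (1 |> D 1).
  by rewrite -rel_diff_op_lim_mul mulg1.
have [i D1i] := lim_mul_inv limG unitG (D 1) complG.
have D1act : 1 |> D 1 = 1.
  rewrite lim_act_1l -[X in _ *oo X]D1i (lim_mulA limG).
  by move: D11; rewrite lim_mul_act1 => <-.
by rewrite D11 D1act -lim_act_1l.
Qed.

End RelativeDifferentialOperator.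
End LimAct.

Theorem proposition4p6 (G : topologicalGroupType) (Phi Psi : nat -> G -> G)
    (Gamma : G -> G -> G)
    (hsync : action_synchronized_lim_group Phi Psi Gamma)
    (habel : lim_abelian_group Phi Psi) :
  (forall D : G -> G,
     relative_differential_operator Phi Psi Gamma D ->
     novikov_group Phi Psi Gamma
       (fun a b => limn (fun n => Psi n (Gamma a (Phi n (D b)))))) /\
  (forall prec : G -> G -> G,
     novikov_group Phi Psi Gamma prec ->
     relative_differential_operator Phi Psi Gamma (fun a => prec 1 a)).
Proof.
have unitG := lim_abelian_group_unital habel.
have complG := lim_abelian_group_complete habel.
split=> [D diffD | prec nov a b].
  have fold_act a b : limn (fun n => Psi n (Gamma a (Phi n (D b))))
      = lim_act Phi Psi Gamma a (D b) by [].
  split=> // [a | a b c | a b c]; rewrite !fold_act.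
  - by rewrite (rel_diff_op1 hsync unitG diffD complG) (lim_act_1r hsync unitG).
  - rewrite (rel_diff_op_lim_mul hsync diffD) (lim_act_mul hsync).
    by rewrite (lim_actM hsync).
  - rewrite -(lim_actM hsync).
    exact: scaled_act_unique_limit hsync _ _ _ (cvgn_cst _).
(* The product axiom at first argument 1 leaves the factor [prec a b], which is [a |> prec 1 b] by
   the action axiom with middle argument 1. *)
have -> : prec 1 (a * b)
    = lim_mul Phi Psi (prec 1 a) (lim_act Phi Psi Gamma a (prec 1 b)).
  rewrite (novikov_precM nov) mul1g; congr lim_mul.
  by rewrite -{1}(mulg1 a); apply/esym/unique_limit_lim/(novikov_act_prec nov).
exact: lim_mul_act_unique_limit.
Qed.
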